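(* For each finite graph $\Gamma$ with $m$ vertices, there exists a finite tree $T$ with $|V(T)|\leqslant m2^{m-1}$ such that $G(\Gamma)$ admits a quasi-isometric group embedding into $G(T)$.
   Context: All graphs are undirected and simplicial. For a graph $\Gamma$, $G(\Gamma)$ is the group with generating set $V(\Gamma)$ and relations $[u,v]=1$ whenever $\{u,v\}$ is not an edge of $\Gamma$ (the right-angled Artin group on the complement graph). A quasi-isometric group embedding from a finitely generated group $G$ to a finitely generated group $H$ is an injective homomorphism $f:G\to H$ that is a quasi-isometric embedding with respect to word metrics, i.e. there is $C\ge1$ with $d(x,y)/C-C\le d(f(x),f(y))\le Cd(x,y)+C$ for all $x,y\in G$. *)

(* Defs.v *)
From Stdlib Require Import Reals Relation_Operators.
From mathcomp Require Import all_boot.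
Set Implicit Arguments. Unset Strict Implicit. Unset Printing Implicit Defensive.

Definition simple_graph (V : finType) (e : rel V) : Prop :=
  symmetric e /\ irreflexive e.

Definition is_tree (V : finType) (e : rel V) : Prop :=
  simple_graph e /\ 0 < #|V| /\
  (forall x y : V, connect e x y) /\
  (forall s : seq V, uniq s -> 3 <= size s -> ~~ cycle e s).

(* Words over V(Gamma)^{+-1}: (v, true) is v, (v, false) is v^{-1}. *)
Definition word (V : Type) := seq (V * bool).

Definition winv (V : Type) (w : word V) : word V :=
  rev (map (fun p => (p.1, ~~ p.2)) w).

(* Elementary moves for the presentation of G(Gamma): free cancellation, and
   commutation of generators x, y whenever {x,y} is NOT an edge of Gamma. *)
Inductive raag_step (V : finType) (e : rel V) : word V -> word V -> Prop :=
| raag_free (u v : word V) (x : V) (b : bool) :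
    raag_step e (u ++ (x, b) :: (x, ~~ b) :: v) (u ++ v)
| raag_comm (u v : word V) (x y : V) (b c : bool) :
    ~~ e x y ->
    raag_step e (u ++ (x, b) :: (y, c) :: v) (u ++ (y, c) :: (x, b) :: v).

Definition raag_eq (V : finType) (e : rel V) : word V -> word V -> Prop :=
  clos_refl_sym_trans (word V) (raag_step e).

Definition is_wlen (V : finType) (e : rel V) (w : word V) (n : nat) : Prop :=
  (exists w', raag_eq e w w' /\ size w' = n) /\
  (forall w', raag_eq e w w' -> n <= size w').

Definition is_wdist (V : finType) (e : rel V) (x y : word V) (n : nat) : Prop :=
  is_wlen e (winv x ++ y) n.

(* A homomorphism out of G(Gamma) is determined by the images of the generators;
   phi assigns to each generator a word representing its image. *)
Definition hom_ext (V W : Type) (phi : V -> word W) (w : word V) : word W :=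
  flatten (map (fun p => if p.2 then phi p.1 else winv (phi p.1)) w).

Definition is_raag_hom (V W : finType) (e : rel V) (f : rel W)
    (phi : V -> word W) : Prop :=
  forall x y : V, ~~ e x y -> raag_eq f (phi x ++ phi y) (phi y ++ phi x).

Definition raag_hom_injective (V W : finType) (e : rel V) (f : rel W)
    (phi : V -> word W) : Prop :=
  forall w : word V, raag_eq f (hom_ext phi w) [::] -> raag_eq e w [::].

Definition raag_qi_embedding (V W : finType) (e : rel V) (f : rel W)
    (phi : V -> word W) : Prop :=
  exists C : R, Rle 1 C /\
    forall (x y : word V) (d d' : nat),
      is_wdist e x y d -> is_wdist f (hom_ext phi x) (hom_ext phi y) d' ->
      Rle (Rminus (Rdiv (INR d) C) C) (INR d') /\
      Rle (INR d') (Rplus (Rmult C (INR d)) C).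

Definition qi_group_embedding (V W : finType) (e : rel V) (f : rel W) : Prop :=
  exists phi : V -> word W,
    [/\ is_raag_hom e f phi, raag_hom_injective e f phi
      & raag_qi_embedding e f phi].

(* Main.v *)
From Stdlib Require Import Reals Lra Relation_Operators.
From mathcomp Require Import all_boot boolp zify.
Require Import Defs.
Set Implicit Arguments. Unset Strict Implicit. Unset Printing Implicit Defensive.

(* A generator x of G(Gamma) is sent to the product of the nodes labelled x of a
   tree T whose adjacent labelled nodes have adjacent labels. For vertex sets U
   and S, a labelled forest F(U, S) is obtained by picking x in both U and S: the
   first tree has a root labelled x above the forest F(U - x, N(x)), and the other
   trees form F(U - x, S). It has at most 2^|U| - 1 nodes, and by Britton's lemma
   applied to its roots, if the image of g in G(U) can be written without the
   roots, then g can be written without S.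
   Let T_x be a root labelled x above F(V - x, N(x)). In the image of a geodesic
   word g, Britton's lemma for the root of T_x yields no pinch, since a pinch would
   shorten g. Hence every word equal to the image of g has at least as many letters
   root(T_x) as g has letters x, so it is at least as long as g. The trees T_x are
   joined to T_(x0), by an edge between the roots if x is adjacent to x0, and
   otherwise through an unlabelled node; in the latter case N(x) misses x0, so
   that T_x has fewer than 2^(m-1) nodes, which pays for the extra node. *)

(** * Words, their inverses and the deletion of letters *)

Definition keep (V : Type) (P : pred V) (w : word V) : word V :=
  [seq p <- w | P p.1].

Definition lcount (V : eqType) (x : V) (w : word V) : nat :=
  count (fun p => p.1 == x) w.

Section Words.
Variable V : Type.
Implicit Types (u v w : word V) (P Q : pred V).

Lemma winv_cat u v : winv (u ++ v) = winv v ++ winv u.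
Proof. by rewrite /winv map_cat rev_cat. Qed.

Lemma winv_cons p w : winv (p :: w) = rcons (winv w) (p.1, ~~ p.2).
Proof. by rewrite /winv /= rev_cons. Qed.

Lemma winvK : involutive (@winv V).
Proof.
elim=> [|[x b] w IH] //.
by rewrite winv_cons -cats1 winv_cat IH /= negbK.
Qed.

Lemma size_winv w : size (winv w) = size w.
Proof. by rewrite size_rev size_map. Qed.

Lemma keep_cat P u v : keep P (u ++ v) = keep P u ++ keep P v.
Proof. exact: filter_cat. Qed.

Lemma keep_winv P w : keep P (winv w) = winv (keep P w).
Proof. by rewrite /keep /winv filter_rev filter_map. Qed.

Lemma keep_id P w : all (fun p => P p.1) w -> keep P w = w.
Proof. exact: all_filterP. Qed.

Lemma all_keep P Q w :
  all (fun p => Q p.1) w -> all (fun p => Q p.1) (keep P w).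
Proof. by rewrite all_filter; apply: sub_all => p /= ->; rewrite implybT. Qed.

Lemma all_winv P w : all (fun p => P p.1) (winv w) = all (fun p => P p.1) w.
Proof. by rewrite all_rev all_map. Qed.
End Words.

(** * Images of words under a map of generators *)

Section HomExt.
Variables V W : Type.
Implicit Type phi : V -> word W.

Lemma hom_ext_cat phi u v : hom_ext phi (u ++ v) = hom_ext phi u ++ hom_ext phi v.
Proof. by rewrite /hom_ext map_cat flatten_cat. Qed.

Lemma hom_ext_winv phi w : hom_ext phi (winv w) = winv (hom_ext phi w).
Proof.
elim: w => [|[x b] w IH] //.
rewrite winv_cons -cats1 hom_ext_cat IH -cat1s hom_ext_cat winv_cat.
by congr (_ ++ _); rewrite /hom_ext /= !cats0; case: b => //=; rewrite winvK.
Qed.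

Lemma keep_hom_ext phi (P : pred W) w :
  keep P (hom_ext phi w) = hom_ext (fun x => keep P (phi x)) w.
Proof.
elim: w => [|[x b] w IH] //.
rewrite -cat1s !hom_ext_cat keep_cat IH; congr (_ ++ _).
by rewrite /hom_ext /= !cats0; case: b => //=; rewrite keep_winv.
Qed.

Lemma all_hom_ext phi (P : pred W) w :
    all (fun p => all (fun q => P q.1) (phi p.1)) w ->
  all (fun q => P q.1) (hom_ext phi w).
Proof.
elim: w => [|[x b] w IH] //= /andP[Px Pw].
rewrite /hom_ext /= all_cat; apply/andP; split; last exact: IH.
by case: b => //; rewrite all_winv.
Qed.
End HomExt.

(** * Equality in G(Gamma) *)

Section Raag.
Variables (V : finType) (e : rel V).
Implicit Types (u v w : word V) (P : pred V).

Lemma raag_eq_refl w : raag_eq e w w. Proof. exact: rst_refl. Qed.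

Lemma raag_eq_sym u v : raag_eq e u v -> raag_eq e v u.
Proof. exact: rst_sym. Qed.

Lemma raag_eq_trans v u w : raag_eq e u v -> raag_eq e v w -> raag_eq e u w.
Proof. exact: rst_trans. Qed.

Lemma raag_eq_ext (W : finType) (f : rel W) (F : word V -> word W) :
    (forall u v, raag_step e u v -> raag_eq f (F u) (F v)) ->
  forall u v, raag_eq e u v -> raag_eq f (F u) (F v).
Proof.
move=> Fstep u v; elim=> {u v} [u v /Fstep //|u|u v _|u v w _ uv _].
- exact: rst_refl.
- exact: rst_sym.
- exact: rst_trans.
Qed.

Lemma raag_eq_catl a u v : raag_eq e u v -> raag_eq e (a ++ u) (a ++ v).
Proof.
move: u v; apply: raag_eq_ext => u v [] *; apply: rst_step; rewrite !catA.
- exact: raag_free.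
- exact: raag_comm.
Qed.

Lemma raag_eq_catr a u v : raag_eq e u v -> raag_eq e (u ++ a) (v ++ a).
Proof.
move: u v; apply: raag_eq_ext => u v [] *; apply: rst_step; rewrite -!catA /=.
- exact: raag_free.
- exact: raag_comm.
Qed.

Lemma raag_catNw w : raag_eq e (winv w ++ w) [::].
Proof.
elim: w => [|[x b] w IH]; first exact: raag_eq_refl.
rewrite winv_cons -cats1 -catA /=; apply: raag_eq_trans IH; apply: rst_step.
by have := raag_free e (winv w) w x (~~ b); rewrite negbK.
Qed.

Lemma raag_catwN w : raag_eq e (w ++ winv w) [::].
Proof. by have := raag_catNw (winv w); rewrite winvK. Qed.

Lemma raag_eq_catKl a u v : raag_eq e (a ++ u) (a ++ v) -> raag_eq e u v.
Proof.
move=> /(raag_eq_catl (winv a)); rewrite !catA => auv.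
have drop z : raag_eq e ((winv a ++ a) ++ z) z by exact: raag_eq_catr (raag_catNw a).
exact: raag_eq_trans (raag_eq_sym (drop u)) (raag_eq_trans auv (drop v)).
Qed.

(** Deletion of letters respects both moves: it is the retraction of G(Gamma) onto the subgroup
    generated by the letters in [P]. *)
Lemma raag_eq_keep P u v : raag_eq e u v -> raag_eq e (keep P u) (keep P v).
Proof.
move: u v; apply: raag_eq_ext => _ _ [u v x b|u v x y b c nxy].
- rewrite /keep !filter_cat /=; case: (P x); last exact: raag_eq_refl.
  by apply: rst_step; apply: raag_free.
- rewrite /keep !filter_cat /=.
  case: (P x); case: (P y); try exact: raag_eq_refl.
  by apply: rst_step; apply: raag_comm.
Qed.

Lemma raag_cat_comm u v :
    all (fun p => all (fun q => ~~ e p.1 q.1) v) u ->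
  raag_eq e (u ++ v) (v ++ u).
Proof.
elim: u => [|p u IH] /=; first by rewrite cats0 => _; apply: raag_eq_refl.
case/andP=> pv /IH uv.
have {uv} uv := raag_eq_catl [:: p] uv.
apply: raag_eq_trans uv _; rewrite /= -cat_cons -[p :: u]cat1s catA.
apply: raag_eq_catr; elim: v pv {IH} => [|q v IH] /=; first by move=> _; apply: raag_eq_refl.
case/andP=> pq /IH pv.
apply: raag_eq_trans (raag_eq_catl [:: q] pv).
case: p pq {IH pv} => x b; case: q => y c /= pq.
by apply: rst_step; apply: (raag_comm [::]).
Qed.
End Raag.

(** * Free reduction over signed letters *)

Section FreeReduction.
Variable C : Type.
Implicit Types (a : bool * C) (s : seq (bool * C)).

Definition finv a := (~~ a.1, a.2).

(** Letters are compared classically because [C] will be a type of sets of words. *)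
Definition fpush a s :=
  if s is b :: s' then (if `[< b = finv a >] then s' else a :: s) else [:: a].

Definition freduce s := foldr fpush [::] s.

Lemma finvK : involutive finv. Proof. by case=> b c; rewrite /finv /= negbK. Qed.

Definition freely_reduced s := forall s1 a s2, s <> s1 ++ a :: finv a :: s2.

Lemma freduce_reduced s : freely_reduced (freduce s).
Proof.
elim: s => [|a s IH] /=; first by case.
case Es: (freduce s) => [|b s'] /=; first by case=> [|? []].
case: asboolP => [Eb|neq] s1 c s2 /=.
  by move=> E; apply: (IH (b :: s1) c s2); rewrite Es E.
case: s1 => [[<- Eb _]|d s1 [_ E]]; first exact: neq.
by apply: (IH s1 c s2); rewrite Es.
Qed.

(** Opposite letters act on reduced words by inverse permutations (van der Waerden's argument),
    which makes [freduce] invariant under cancellation. *)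
Lemma fpushK a s : freely_reduced s -> fpush a (fpush (finv a) s) = s.
Proof.
case: s => [|b s] red /=; first by case: asboolP.
case: asboolP => [Eb|neq] /=; last by case: asboolP.
case: s red => [|c s] red /=; first by rewrite Eb finvK.
case: asboolP => [Ec|nEc]; last by rewrite Eb finvK.
by case: (red [::] b s); rewrite Ec Eb finvK.
Qed.

Lemma freduce_cancel s1 a s2 :
  freduce (s1 ++ a :: finv a :: s2) = freduce (s1 ++ s2).
Proof.
by rewrite /freduce !foldr_cat /= fpushK //; apply: freduce_reduced.
Qed.

Lemma size_freduce s : size (freduce s) <= size s.
Proof.
elim: s => //= a s; case: (freduce s) => [|b s'] //= le_s.
by case: asboolP => E //=; apply: leq_trans (leqnSn _); apply: ltnW.
Qed.

Lemma freduceP s :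
  freduce s = s \/ exists s1 a s2, s = s1 ++ a :: finv a :: s2.
Proof.
elim: s => [|a s [IH|[s1 [b [s2 ->]]]]]; first by left.
  rewrite /= IH; case: s IH => [|b s] _ /=; first by left.
  case: asboolP => [->|neq]; last by left.
  by right; exists [::], a, s.
by right; exists (a :: s1), b, s2.
Qed.
End FreeReduction.

(** * Britton's lemma for one stable letter *)

Section Britton.
Variables (V : finType) (e : rel V).
Hypothesis e_sym : symmetric e.
Variable r : V.
Implicit Types (h u v w : word V).

Definition centralizing w := all (fun p => (p.1 != r) && ~~ e r p.1) w.

(** A left coset of the subgroup generated by the letters other than [r] that commute with [r]. As a
    predicate on words it turns equality of cosets into plain equality. *)
Definition coset h : word V -> Prop :=
  fun z => exists2 a, centralizing a & raag_eq e z (h ++ a).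

(** With [h] collecting the other letters read so far, each [r] stands for its conjugate by [h],
    which depends only on the coset of [h]. *)
Fixpoint syllables h w : seq (bool * (word V -> Prop)) :=
  if w is p :: w' then
    if p.1 == r then (p.2, coset h) :: syllables h w'
    else syllables (rcons h p) w'
  else [::].

Lemma coset_raag_eq h h' : raag_eq e h h' -> coset h = coset h'.
Proof.
move=> hh'; apply/funext => z; apply/propext.
split=> -[a Aa za]; exists a => //; apply: raag_eq_trans za _.
  exact: raag_eq_catr.
exact/raag_eq_catr/raag_eq_sym.
Qed.

Lemma coset_rcons h y c :
  y != r -> ~~ e r y -> coset (rcons h (y, c)) = coset h.
Proof.
move=> yr ry; apply/funext => z; apply/propext; split=> -[a Aa za].
  by exists ((y, c) :: a); rewrite /= ?yr ?ry // -cat_rcons.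
exists ((y, ~~ c) :: a); first by rewrite /= yr ry.
apply: raag_eq_trans za _; apply: raag_eq_sym.
by rewrite cat_rcons; apply: rst_step; apply: raag_free.
Qed.

Lemma syllables_cat h u v :
  syllables h (u ++ v) = syllables h u ++ syllables (h ++ keep (predC1 r) u) v.
Proof.
elim: u h => [|p u IH] h /=; first by rewrite cats0.
by case: eqP => _ /=; rewrite IH //= cat_rcons.
Qed.

Lemma syllables_raag_eq h h' w : raag_eq e h h' -> syllables h w = syllables h' w.
Proof.
elim: w h h' => [|p w IH] h h' hh' //=.
rewrite (coset_raag_eq hh') (IH _ _ hh'); congr (if _ then _ else _).
by apply: IH; rewrite -!cats1; apply: raag_eq_catr.
Qed.

Lemma size_syllables h w : size (syllables h w) = lcount r w.
Proof.
by elim: w h => [|p w IH] h //=; case: eqP => _ /=; rewrite IH ?add1n.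
Qed.

(** A letter commuting with [r] crosses it without changing the coset, moves away from [r] alter
    prefixes within their class, and moves among letters [r] change the syllables by free
    cancellation only. *)
Lemma freduce_syllables u v :
  raag_eq e u v -> freduce (syllables [::] u) = freduce (syllables [::] v).
Proof.
elim=> {u v} [u v|//|u v _ -> //|u v w _ -> _ -> //].
case=> {u v} [u v x b|u v x y b c nxy]; rewrite !syllables_cat /=.
  case: eqP => [_|_]; first exact: (freduce_cancel _ (b, _)).
  congr (freduce (_ ++ _)); apply: syllables_raag_eq.
  rewrite -!cats1 -catA -[X in raag_eq _ _ X]cats0.
  by apply/raag_eq_catl/rst_step/(raag_free _ [::] [::]).
set h := keep _ u; have [Ex|xr] := eqVneq x r; have [Ey|yr] := eqVneq y r; rewrite ?Ex ?Ey /= in nxy *.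
- have [->//|bc] := eqVneq b c.
  have -> : c = ~~ b by case: b c bc => [] [].
  set t := syllables _ v; set s := syllables _ u.
  have := freduce_cancel s (~~ b, coset h) t; rewrite /finv /= negbK => ->.
  exact: (freduce_cancel s (b, coset h) t).
- by rewrite coset_rcons.
- by rewrite coset_rcons // e_sym.
congr (freduce (_ ++ _)); apply: syllables_raag_eq.
rewrite -!cats1 -!catA; apply/raag_eq_catl/rst_step.
exact: (raag_comm [::] [::]).
Qed.

Lemma syllables_split h w s1 a s2 :
    syllables h w = s1 ++ a :: s2 ->
  exists u v, [/\ w = u ++ (r, a.1) :: v, syllables h u = s1,
    a.2 = coset (h ++ keep (predC1 r) u)
    & syllables (h ++ keep (predC1 r) u) v = s2].
Proof.
elim: w h s1 => [|[x b] w IH] h s1 /=; first by case: s1.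
case: eqVneq => [->|xr]; last first.
  case/IH=> u [v [-> <- -> <-]].
  by exists ((x, b) :: u), v; rewrite /= (negPf xr) cat_rcons.
case: s1 => [[<- <-]|c s1 [<- /IH[u [v [-> <- -> <-]]]]].
  by exists [::], w; rewrite cats0.
by exists ((r, b) :: u), v; rewrite /= eqxx.
Qed.

(* Britton's lemma for G(Gamma) viewed as an HNN extension with stable letter
   r: collecting the letters other than r on the right turns w into a product
   of conjugates of r^{+-1}, indexed by left cosets of the centralizer, and
   such conjugates freely generate the normal closure of r. *)
Lemma raag_pinch w w' :
    raag_eq e w w' -> lcount r w' < lcount r w ->
  exists u b g v, [/\ w = u ++ (r, b) :: g ++ (r, ~~ b) :: v,
    all (fun p => p.1 != r) g & raag_eq e g (keep (fun x => ~~ e r x) g)].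
Proof.
move=> ww'; rewrite -!(size_syllables [::]) => lt_ww'.
(* A freely reduced list of syllables is never longer than that of an equal word, so two consecutive
   syllables of [w] are inverse to each other. *)
have [red_w|[s1 [a [s2 Es]]]] := freduceP (syllables [::] w).
  have := size_freduce (syllables [::] w').
  by rewrite -(freduce_syllables ww') red_w leqNgt lt_ww'.
have [u [v [-> _ Ea Ev]]] := syllables_split Es.
have [g [v' [-> Eg Ea' _]]] := @syllables_split _ v [::] (finv a) s2 Ev.
have g_r : all (fun p => p.1 != r) g.
  rewrite all_predC has_count -leqNgt.
  by rewrite -[count _ _](size_syllables (keep (predC1 r) u)) Eg.
exists u, a.1, g, v'; split=> //.
move: Ea'; rewrite /= Ea !cat0s (keep_id g_r) => Ecoset.
(* Equal cosets put [g] in the subgroup of centralizing letters, which is fixed by deletion of the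
   neighbours of [r]. *)
have : coset (keep (predC1 r) u ++ g) (keep (predC1 r) u ++ g).
  by exists [::]; rewrite ?cats0 //; apply: raag_eq_refl.
rewrite -Ecoset => -[z Az /raag_eq_catKl gz].
apply: (raag_eq_trans gz); apply: raag_eq_sym.
have := raag_eq_keep (fun x => ~~ e r x) gz.
rewrite (@keep_id _ _ z) //.
by apply: sub_all Az => p /andP[].
Qed.
End Britton.

(** * Letter counts, and a letter that can be read back from an image *)

Section LetterCount.
Variables (V : eqType) (x : V).
Implicit Types u v w : word V.

Lemma lcount_cons p w : lcount x (p :: w) = (p.1 == x) + lcount x w.
Proof. by []. Qed.

Lemma lcount_cat u v : lcount x (u ++ v) = lcount x u + lcount x v.
Proof. exact: count_cat. Qed.

Lemma lcount_keep P w : lcount x (keep P w) <= lcount x w.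
Proof. by rewrite /lcount count_filter; apply: sub_count => p /andP[]. Qed.

Lemma lcount_eq0 w : (lcount x w == 0) = all (fun p => p.1 != x) w.
Proof. by rewrite all_predC has_count lt0n negbK. Qed.
End LetterCount.

Section Survive.
Variables (V W : eqType) (phi : V -> word W) (u : V) (r : W).
Hypotheses (phi_u : phi u = [:: (r, true)])
  (phi_r : forall x, x != u -> all (fun q => q.1 != r) (phi x)).

Lemma hom_ext_letter b : hom_ext phi [:: (u, b)] = [:: (r, b)].
Proof. by rewrite /hom_ext /= phi_u; case: b. Qed.

Lemma hom_ext_letter_avoid x b :
  x != u -> all (fun q => q.1 != r) (hom_ext phi [:: (x, b)]).
Proof. by move=> xu; apply: (all_hom_ext (P := predC1 r)); rewrite /= phi_r. Qed.

Lemma lcount_hom_ext w : lcount r (hom_ext phi w) = lcount u w.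
Proof.
elim: w => [|[x b] w IH] //; rewrite /lcount -cat1s [RHS]count_cat -[count _ w]IH.
rewrite hom_ext_cat count_cat; congr (_ + _).
have [->|xu] := eqVneq x u; first by rewrite hom_ext_letter /= !eqxx.
rewrite [RHS]/= (negPf xu); apply/eqP.
by rewrite [_ == _]lcount_eq0 hom_ext_letter_avoid.
Qed.

Lemma hom_ext_split w s1 b s2 :
    hom_ext phi w = s1 ++ (r, b) :: s2 ->
  exists w1 w2, [/\ w = w1 ++ (u, b) :: w2, hom_ext phi w1 = s1
    & hom_ext phi w2 = s2].
Proof.
elim: w s1 => [|[x c] w IH] s1; first by case: s1.
rewrite -cat1s hom_ext_cat; have [->|xu] := eqVneq x u.
  rewrite hom_ext_letter; case: s1 => [[<- <-]|q s1 /= [<- /IH[w1 [w2 [-> <- <-]]]]].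
    by exists [::], w.
  exists ((u, c) :: w1), w2; split=> //.
  by rewrite -cat1s hom_ext_cat hom_ext_letter.
have := hom_ext_letter_avoid c xu; set s := hom_ext _ [:: _] => s_r Es.
(* No letter of [s] is [r], so [s] ends before the given occurrence of [r]. *)
have [s1' Es1] : exists s1', s1 = s ++ s1'.
  elim: s s1 s_r Es {IH} => [|q s IHs] s1 /=; first by exists s1.
  case/andP=> qr s_r; case: s1 => [[Eq _]|q' s1 [<- /(IHs _ s_r)[s1' ->]]].
    by rewrite Eq eqxx in qr.
  by exists s1'.
move: Es; rewrite Es1 -catA => /eqP; rewrite eqseq_cat // eqxx /= => /eqP.
case/IH=> w1 [w2 [-> <- <-]]; exists ((x, c) :: w1), w2; split=> //.
by rewrite -cat1s hom_ext_cat.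
Qed.
End Survive.

(* blocks e adj lab U S i: for every word g over U, if the image of g under
   the lift map below can be written without the neighbours of the node i,
   then g can be written without the letters of S; cf. blocks_avoid. *)
Inductive blocks (V : finType) (e : rel V) (N : Type) (adj : rel N)
    (lab : N -> option V) : {set V} -> {set V} -> N -> Prop :=
| blocks_nil (U S : {set V}) i : [disjoint U & S] -> blocks e adj lab U S i
| blocks_cons (U S : {set V}) i x j :
    adj i j -> lab j = Some x ->
    blocks e adj lab (U :\ x) [set y | e x y] j ->
    blocks e adj lab (U :\ x) S i ->
    blocks e adj lab U S i.

(** By the retraction, [w] equals some word without letters of [S] exactly when deleting these
    letters leaves its class unchanged. *)
Definition avoids (V : finType) (e : rel V) (S : pred V) (w : word V) :=
  raag_eq e w (keep (predC S) w).

Lemma avoids_raag_eq (V : finType) (e : rel V) S (w w' : word V) :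
  raag_eq e w w' -> avoids e S w -> avoids e S w'.
Proof.
move=> ww' Sw; apply: raag_eq_trans (raag_eq_sym ww') _.
by apply: raag_eq_trans Sw _; apply: raag_eq_keep.
Qed.

Lemma avoidsS (V : finType) (e : rel V) (S S' : pred V) (w : word V) :
  subpred S' S -> avoids e S w -> avoids e S' w.
Proof.
move=> sS'S Sw; apply: (raag_eq_trans Sw); apply: raag_eq_sym.
have := raag_eq_keep (predC S') Sw; rewrite (keep_id (w := keep _ _)) //.
apply: sub_all (filter_all _ _) => p /=.
by apply: contra; apply: sS'S.
Qed.

(** * The lift along a labelling, and the removal of pinches *)

Section Lift.
Variables (V W : finType) (e : rel V) (t : rel W) (lab : W -> option V).
Hypothesis t_sym : symmetric t.
Hypothesis lab_adj : forall i j x y,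
  lab i = Some x -> lab j = Some y -> t i j -> e x y.
Implicit Types (g : word V) (x : V) (r : W).

Definition lift x : word W := [seq (i, true) | i <- enum W & lab i == Some x].

Lemma lab_lift x : all (fun q => lab q.1 == Some x) (lift x).
Proof. by rewrite all_map; apply: filter_all. Qed.

Lemma lab_hom_ext_lift x b :
  all (fun q => lab q.1 == Some x) (hom_ext lift [:: (x, b)]).
Proof. by apply: (all_hom_ext (P := fun i => lab i == Some x)); rewrite /= lab_lift. Qed.

Lemma size_lift x : size (lift x) <= #|W|.
Proof. by rewrite size_map size_filter cardE count_size. Qed.

Lemma lift_comm x y b c : ~~ e x y ->
  raag_eq t (hom_ext lift [:: (x, b)] ++ hom_ext lift [:: (y, c)])
            (hom_ext lift [:: (y, c)] ++ hom_ext lift [:: (x, b)]).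
Proof.
move=> nxy; apply: raag_cat_comm.
apply: sub_all (lab_hom_ext_lift x b) => p /eqP px.
apply: sub_all (lab_hom_ext_lift y c) => q /eqP qy.
by apply: contra nxy; apply: lab_adj.
Qed.

Lemma lift_hom : is_raag_hom e t lift.
Proof.
by move=> x y /(lift_comm true true); rewrite /hom_ext /= !cats0.
Qed.

Lemma raag_eq_lift g g' :
  raag_eq e g g' -> raag_eq t (hom_ext lift g) (hom_ext lift g').
Proof.
move: g g'; apply: raag_eq_ext => _ _ [u v x b|u v x y b c nxy];
  rewrite !hom_ext_cat; apply: raag_eq_catl.
  rewrite -[(x, b) :: _]/([:: (x, b)] ++ [:: (x, ~~ b)] ++ v) !hom_ext_cat catA.
  rewrite -[X in raag_eq _ _ X]cat0s.
  apply: raag_eq_catr; rewrite -[[:: (x, ~~ b)]]/(winv [:: (x, b)]).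
  by rewrite hom_ext_winv; apply: raag_catwN.
have splitE z d z' d' : hom_ext lift [:: (z, d), (z', d') & v] =
    (hom_ext lift [:: (z, d)] ++ hom_ext lift [:: (z', d')]) ++ hom_ext lift v.
  by rewrite -!hom_ext_cat.
by rewrite !splitE; apply: raag_eq_catr; apply: lift_comm.
Qed.

(** Deleting every node labelled [x] except [r] makes [r] the image of [x] alone, so the pinch given
    by [raag_pinch] comes from two letters of [g]. *)
Lemma lift_pinch r x g w' :
    lab r = Some x -> raag_eq t (hom_ext lift g) w' ->
    lcount r w' < lcount x g ->
  exists u b g' v, [/\ g = u ++ (x, b) :: g' ++ (x, ~~ b) :: v,
    all (fun p => p.1 != x) g'
    & raag_eq t (hom_ext lift g')
        (keep (fun i => ~~ t r i) (hom_ext lift g'))].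
Proof.
move=> lab_r gw' lt_w'g.
pose D i := (i == r) || (lab i != Some x); pose psi y := keep D (lift y).
have psi_x : psi x = [:: (r, true)].
  rewrite /psi /keep /lift filter_map -filter_predI.
  rewrite (@eq_filter _ _ (pred1 r)) ?filter_pred1_uniq ?enum_uniq ?mem_enum //.
  move=> i /=; rewrite /D; case: eqVneq => [->|_] /=; first by rewrite lab_r eqxx.
  by rewrite andNb.
have psi_r y : y != x -> all (fun q => q.1 != r) (psi y).
  move=> yx; apply: (@all_keep _ _ (predC1 r)); apply: sub_all (lab_lift y) => q /eqP lab_q.
  by apply: contra_neq yx => qr; move: lab_q; rewrite qr lab_r => -[].
have := raag_eq_keep D gw'; rewrite keep_hom_ext -/psi => psi_gw'.
have [|u [b [g' [v [Eg g'_r g'_t]]]]] := raag_pinch t_sym psi_gw' (r := r).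
  rewrite (lcount_hom_ext psi_x psi_r); apply: leq_ltn_trans lt_w'g.
  exact: lcount_keep.
have [w1 [w2 [Ew1 Eu Ew2]]] := hom_ext_split psi_x psi_r Eg.
have [w3 [w4 [Ew3 Eg' Ew4]]] := hom_ext_split psi_x psi_r Ew2.
have w3_x : all (fun p => p.1 != x) w3.
  by rewrite -lcount_eq0 -(lcount_hom_ext psi_x psi_r) Eg' lcount_eq0.
(* No [x] lies between the two letters, so the deletion left this part intact. *)
have psi_w3 : hom_ext psi w3 = hom_ext lift w3.
  rewrite -keep_hom_ext keep_id //; apply: (all_hom_ext (P := D)).
  apply: sub_all w3_x => p px; apply: sub_all (lab_lift p.1) => q /eqP lab_q.
  by rewrite /D lab_q; apply/orP; right; apply: contra_neq px => -[].
exists w1, b, w3, w4; split=> //; first by rewrite Ew1 Ew3.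
by rewrite -psi_w3 Eg'.
Qed.


Lemma lcount_keep0 r w : lcount r (keep (predC1 r) w : word W) = 0.
Proof.
by apply/eqP; rewrite lcount_eq0; apply: filter_all.
Qed.

(** The word between the two letters of a pinch has an image that avoids the neighbours of [r]. By
    assumption it can be rewritten without neighbours of [x], and the two letters cancel across
    it. *)
Lemma lift_shorten U r x g w' :
    lab r = Some x ->
    (forall g', all (fun p => p.1 \in U :\ x) g' ->
      avoids t (t r) (hom_ext lift g') -> avoids e (e x) g') ->
    all (fun p => p.1 \in U) g -> raag_eq t (hom_ext lift g) w' ->
    lcount r w' < lcount x g ->
  exists g', [/\ raag_eq e g g', all (fun p => p.1 \in U) g',
    lcount x g' < lcount x g & size g' < size g].
Proof.
move=> lab_r avoid_nbrs gU gw' lt_w'g.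
have [u [b [g' [v [Eg g'x g't]]]]] := lift_pinch lab_r gw' lt_w'g.
have g'U : all (fun p => p.1 \in U :\ x) g'.
  apply/allP => p pg'; rewrite !inE (allP g'x) //= (allP gU) // Eg.
  by rewrite mem_cat inE mem_cat pg' !orbT.
have {}g't := avoid_nbrs g' g'U g't.
set k := keep (predC (e x)) g' in g't.
exists (u ++ k ++ v); split.
- rewrite Eg; apply: raag_eq_catl.
  apply: raag_eq_trans (raag_eq_catl [:: (x, b)] (raag_eq_catr _ g't)) _.
  rewrite -/k -cat_rcons -cats1 !catA; apply: raag_eq_catr.
  apply: raag_eq_trans (raag_eq_catr _ (raag_cat_comm _)) _.
    by rewrite /= andbT; apply: filter_all.
  rewrite -catA -[X in raag_eq _ _ X]cats0; apply: raag_eq_catl.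
  exact: (raag_catwN e [:: (x, b)]).
- move: gU; rewrite Eg !all_cat /= all_cat /= => /and5P[-> _ g'U' _ ->].
  by rewrite andbT /=; apply: all_keep.
- rewrite Eg !lcount_cat !lcount_cons eqxx !lcount_cat !lcount_cons eqxx /=.
  have: lcount x k <= lcount x g' by exact: lcount_keep.
  by lia.
- rewrite Eg !size_cat /= size_cat /=.
  have: size k <= size g' by rewrite size_filter count_size.
  by lia.
Qed.

(** While [x] occurs in [g], the image has a representative with fewer letters [r], namely none, so
    [lift_shorten] lowers the count of [x]. *)
Lemma avoids_letter U r x g :
    lab r = Some x ->
    (forall g', all (fun p => p.1 \in U :\ x) g' ->
      avoids t (t r) (hom_ext lift g') -> avoids e (e x) g') ->
    all (fun p => p.1 \in U) g -> avoids t (pred1 r) (hom_ext lift g) ->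
  exists2 g', raag_eq e g g' & all (fun p => p.1 \in U :\ x) g'.
Proof.
move=> lab_r avoid_nbrs; have [n] := ubnP (lcount x g).
elim: n g => // n IH g lt_gn gU g_r.
have [g_x|] := posnP (lcount x g).
  exists g; first exact: raag_eq_refl.
  apply/allP => p pg; rewrite !inE (allP gU) // andbT.
  by move/eqP: g_x; rewrite lcount_eq0 => /allP->.
rewrite -(lcount_keep0 r (hom_ext lift g)) => lt_g.
have [g1 [gg1 g1U lt_g1 _]] := lift_shorten lab_r avoid_nbrs gU g_r lt_g.
have [||g2 g12 g2U] := IH g1 _ g1U.
- by rewrite -ltnS; apply: leq_ltn_trans lt_gn.
- by apply: avoids_raag_eq g_r; apply: raag_eq_lift.
by exists g2 => //; apply: raag_eq_trans gg1 g12.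
Qed.

(** At a child [j] labelled [x], the forest of [j] supplies the hypothesis of [avoids_letter], which
    removes [x] from [g]; the remaining forest handles the resulting word over [U :\ x]. *)
Lemma blocks_avoid U S i g :
    blocks e t lab U S i -> all (fun p => p.1 \in U) g ->
  avoids t (t i) (hom_ext lift g) -> avoids e (mem S) g.
Proof.
move=> B; elim: B g => {U S i} [U S i dUS|U S i x j ij lab_j _ IHj _ IHi] g gU gi.
  rewrite /avoids keep_id; first exact: raag_eq_refl.
  by apply: sub_all gU => p /(disjointFr dUS) /= ->.
have [||g' gg' g'U] := @avoids_letter U j x g lab_j _ gU.
- by move=> g' g'U /(IHj _ g'U); apply: avoidsS => y; rewrite /= inE.
- by apply: avoidsS gi => _ /eqP ->.
have /IHi -/(_ g'U) : avoids t (t i) (hom_ext lift g').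
  by apply: avoids_raag_eq gi; apply: raag_eq_lift.
by apply: avoids_raag_eq; apply: raag_eq_sym.
Qed.

(** * Word lengths under the lift *)

Variable root : V -> W.
Hypotheses (lab_root : forall x, lab (root x) = Some x)
  (blocks_root : forall x, blocks e t lab [set~ x] [set y | e x y] (root x)).

(** A node has at most one label, so a letter is counted for at most one root. *)
Lemma sum_lcount_root (w : word W) : \sum_x lcount (root x) w <= size w.
Proof.
elim: w => [|q w IH]; first by rewrite big1.
under eq_bigr do rewrite lcount_cons.
rewrite big_split /= -[(size w).+1]add1n leq_add //.
apply: (@leq_trans (\sum_x (lab q.1 == Some x))).
  by apply: leq_sum => x _; case: eqP => // ->; rewrite lab_root eqxx.
case: (lab q.1) => [y|]; last by rewrite big1.
by rewrite (bigD1 y) //= eqxx big1 // => x /negPf xy; rewrite eqE /= eq_sym xy.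
Qed.

Lemma size_lcount g : size g = \sum_x lcount x g.
Proof.
elim: g => [|p g IH]; first by rewrite big1.
under eq_bigr do rewrite lcount_cons.
rewrite big_split /= -IH (bigD1 p.1) //= eqxx big1 // => x /negPf xp.
by rewrite eq_sym xp.
Qed.

(** Too few letters [root x] in [w'] would let [lift_shorten] shorten the geodesic [g]; the counts
    are then summed over [x]. *)
Lemma lift_geodesic g w' :
    (forall g', raag_eq e g g' -> size g <= size g') ->
  raag_eq t (hom_ext lift g) w' -> size g <= size w'.
Proof.
move=> g_min gw'; apply: leq_trans (sum_lcount_root w').
rewrite size_lcount; apply: leq_sum => x _; rewrite leqNgt; apply/negP => lt_x.
have [||g' [gg' _ _ lt_g']] := @lift_shorten setT _ _ g w' (lab_root x) _ _ gw' lt_x.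
- move=> g' g'x.
  have {}g'x : all (fun p => p.1 \in [set~ x]) g'.
    by apply: sub_all g'x => p; rewrite !inE andbT.
  by move=> /(blocks_avoid (blocks_root x) g'x); apply: avoidsS => y; rewrite /= inE.
- by apply/allP => p _; rewrite inE.
by have := g_min g' gg'; rewrite leqNgt lt_g'.
Qed.

Lemma is_wlen_min g n :
  is_wlen e g n -> exists2 g', raag_eq e g g' & size g' = n /\
    forall g'', raag_eq e g' g'' -> size g' <= size g''.
Proof.
move=> [[g' [gg' <-]] g_min]; exists g' => //; split=> // g'' g'g''.
by apply: g_min; apply: raag_eq_trans gg' g'g''.
Qed.

Lemma wlen_lift g d d' :
  is_wlen e g d -> is_wlen t (hom_ext lift g) d' -> d <= d' <= #|W| * d.
Proof.
move=> /is_wlen_min[g' gg' [<- g'_min]] [[w [gw <-]] w_min].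
have gg't := raag_eq_lift gg'.
apply/andP; split.
  by apply: lift_geodesic g'_min _; apply: raag_eq_trans (raag_eq_sym gg't) gw.
apply: leq_trans (w_min _ gg't) _.
elim: g' {gg' g'_min gg't} => [|[x b] g' IH] //=.
rewrite mulnS -cat1s hom_ext_cat size_cat leq_add //.
rewrite /hom_ext /= cats0; case: b; rewrite ?size_winv; exact: size_lift.
Qed.

Lemma wlen_exists g : exists n, is_wlen e g n.
Proof.
pose P n := `[< exists2 g', raag_eq e g g' & size g' = n >].
have exP : exists n, P n.
  by exists (size g); apply/asboolP; exists g => //; apply: raag_eq_refl.
exists (ex_minn exP); case: ex_minnP => n /asboolP[g' gg' Eg'] n_min.
split; first by exists g'.
by move=> g'' gg''; apply: n_min; apply/asboolP; exists g''.
Qed.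

(** A geodesic representative of [g] is no longer than the empty word. *)
Lemma lift_injective : raag_hom_injective e t lift.
Proof.
move=> g g1; have [n /is_wlen_min[g' gg' [_ g'_min]]] := wlen_exists g.
have : size g' <= size (Nil (W * bool)).
  apply: lift_geodesic g'_min _; apply: raag_eq_trans g1.
  exact/raag_eq_sym/raag_eq_lift.
by rewrite leqn0 size_eq0 => /eqP Eg'; rewrite Eg' in gg'.
Qed.

Lemma lift_qi : 0 < #|W| -> raag_qi_embedding e t lift.
Proof.
(* Since [d <= d' <= #|W| * d], the number of nodes serves for both bounds. *)
move=> W_gt0; exists (INR #|W|).
have C1 : Rle 1 (INR #|W|) by apply: (le_INR 1); apply/leP.
split=> // x y d d'; rewrite /is_wdist -hom_ext_winv -hom_ext_cat => dx dy.
have /andP[/leP/le_INR le_d /leP/le_INR] := wlen_lift dx dy.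
rewrite mult_INR; have := pos_INR d; set C := INR #|W| in C1 *.
have : Rle (Rinv C) 1 by rewrite -Rinv_1; apply: Rinv_le_contravar; lra.
by rewrite /Rdiv; split; nra.
Qed.

End Lift.

(** * Growing rooted trees by appending nodes *)

Section Grow.
Variables (V : finType) (e : rel V).
Hypothesis e_sym : symmetric e.

(* A rooted tree with nodes 0, ..., size s - 1: the i-th entry of s consists of
   the parent of the node i (ignored for the root 0) and of its label. *)
Implicit Type s : seq (nat * option V).

Definition parent s i := (nth (0, None) s i).1.
Definition label s i := (nth (0, None) s i).2.

Definition tree_adj s : rel nat := fun i j =>
  [&& i < size s, j < size s
    & (0 < i) && (parent s i == j) || (0 < j) && (parent s j == i)].

(** An unlabelled node is compatible with every node, hence can link any two trees. *)
Definition compatible (l l' : option V) :=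
  if (l, l') is (Some x, Some y) then e x y else true.

Definition wf_tree s :=
  forall i, 0 < i -> i < size s ->
    parent s i < i /\ compatible (label s (parent s i)) (label s i).

Lemma parent_cat s s' i : i < size s -> parent (s ++ s') i = parent s i.
Proof. by rewrite /parent nth_cat => ->. Qed.

Lemma label_cat s s' i : i < size s -> label (s ++ s') i = label s i.
Proof. by rewrite /label nth_cat => ->. Qed.

Lemma label_size s p s' : label (s ++ p :: s') (size s) = p.2.
Proof. by rewrite /label nth_cat ltnn subnn. Qed.

Lemma tree_adj_cat s s' i j : tree_adj s i j -> tree_adj (s ++ s') i j.
Proof.
case/and3P=> lt_i lt_j ij.
by rewrite /tree_adj size_cat !ltn_addr // !parent_cat.
Qed.

Lemma tree_adj_size s i l s' : i < size s ->
  tree_adj (s ++ (i, l) :: s') i (size s).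
Proof.
move=> lt_i; rewrite /tree_adj size_cat ltn_addr //= -ltn_psubLR // subnn /=.
apply/orP; right; rewrite (leq_ltn_trans _ lt_i) //=.
by rewrite /parent nth_cat ltnn subnn.
Qed.

Lemma wf_tree_rcons s i l : wf_tree s -> i < size s ->
  compatible (label s i) l -> wf_tree (s ++ [:: (i, l)]).
Proof.
move=> wf_s lt_i cil j j_gt0; rewrite size_cat addn1 ltnS leq_eqVlt.
case: eqP => [-> _|_ /= lt_j].
  rewrite label_size /parent nth_cat ltnn subnn /=; split=> //.
  by rewrite label_cat.
have [lt_pj cj] := wf_s j j_gt0 lt_j.
by rewrite parent_cat // !label_cat // (ltn_trans lt_pj).
Qed.

Lemma blocks_cat s s' U S i :
  blocks e (tree_adj s) (label s) U S i ->
  blocks e (tree_adj (s ++ s')) (label (s ++ s')) U S i.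
Proof.
elim=> {U S i} [U S i dUS|U S i x j ij lab_j _ IHj _ IHi].
  exact: blocks_nil.
apply: blocks_cons IHj IHi; first exact: tree_adj_cat.
by rewrite label_cat //; case/and3P: ij.
Qed.

(** A node for [x] and two forests over [U :\ x] give f(n) = 1 + 2 f(n-1), so f(n) = 2^n - 1. One
    node is saved if [U] is not inside [S]; as [x] is in [S], the saving is inherited from the
    forest with the same [S]. *)
Lemma grow_blocks s i (U S : {set V}) :
    wf_tree s -> i < size s ->
    (forall x, x \in S -> compatible (label s i) (Some x)) ->
  exists s', [/\ wf_tree (s ++ s'),
    blocks e (tree_adj (s ++ s')) (label (s ++ s')) U S i
    & size s' + ~~ (U \subset S) < 2 ^ #|U|].
Proof.
have [n] := ubnP #|U|; elim: n s i U S => // n IH s i U S lt_Un wf_s lt_i cS.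
have [dUS|] := boolP [disjoint U & S].
  exists [::]; rewrite cats0; split=> //; first exact: blocks_nil.
  (* An empty [U] lies in [S]; for a nonempty one, [2 ^ #|U|] is at least 2, which covers the saved
     unit. *)
  have [->|[x Ux]] := set_0Vmem U; first by rewrite sub0set cards0.
  have : 0 < 2 ^ #|U :\ x| by rewrite expn_gt0.
  by rewrite (cardsD1 x U) Ux expnS; case: (_ \subset _) => /=; lia.
case/pred0Pn=> x /andP[/= Ux Sx].
have EU : #|U| = #|U :\ x|.+1 by rewrite (cardsD1 x) Ux.
have lt_U1n : #|U :\ x| < n by move: lt_Un; rewrite EU.
have wf1 := wf_tree_rcons wf_s lt_i (cS x Sx); set s1 := s ++ _ in wf1.
have size1 : size s1 = (size s).+1 by rewrite size_cat addn1.
have [||s2 [wf2 B2 le2]] := IH s1 (size s) (U :\ x) [set y | e x y] lt_U1n wf1.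
- by rewrite size1.
- by move=> y; rewrite inE label_size.
have lt_i2 : i < size (s1 ++ s2) by rewrite size_cat size1; lia.
have [|s3 [wf3 B3 le3]] := IH (s1 ++ s2) i (U :\ x) S lt_U1n wf2 lt_i2.
  by rewrite !label_cat //; lia.
have Es : s ++ (i, Some x) :: s2 ++ s3 = (s1 ++ s2) ++ s3 by rewrite -!catA.
exists ((i, Some x) :: s2 ++ s3); rewrite Es; split=> //.
  apply: blocks_cons (blocks_cat _ B2) B3; rewrite -Es.
    exact: tree_adj_size.
  by rewrite label_size.
have -> : (U \subset S) = (U :\ x \subset S).
  by rewrite -{1}(setD1K Ux) subUset sub1set Sx.
rewrite EU expnS mul2n -addnn /= size_cat; move: le2 le3; lia.
Qed.

Lemma plant_trees (x0 : V) (xs : seq V) : x0 \notin xs ->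
  exists s, [/\ wf_tree s, 0 < size s, label s 0 = Some x0,
    size s <= (size xs).+1 * 2 ^ #|V|.-1
    & forall x, x \in x0 :: xs -> exists i, [/\ i < size s, label s i = Some x
      & blocks e (tree_adj s) (label s) [set~ x] [set y | e x y] i]].
Proof.
elim: xs => [_|x xs IH].
  have [|//||s' [wf_s' B le_s']] :=
    @grow_blocks [:: (0, Some x0)] 0 [set~ x0] [set y | e x0 y].
  - by case.
  - by move=> y; rewrite inE.
  exists ((0, Some x0) :: s'); split=> //.
    by rewrite mul1n; move: le_s'; rewrite cardsC1 /=; lia.
  by move=> x; rewrite inE => /eqP ->; exists 0.
rewrite inE negb_or => /andP[x0x /IH{IH}[s [wf_s s_gt0 lab0 le_s root_s]]].
(* Here [s1] attaches the new root [i] to [s]. Two nodes are allowed only if [x] has a non-neighbour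
   other than itself, when [grow_blocks] saves one. *)
have grow s1 i : wf_tree (s ++ s1) -> i < size (s ++ s1) ->
    label (s ++ s1) i = Some x ->
    size s1 <= (~~ ([set~ x] \subset [set y | e x y])).+1 ->
  exists s, [/\ wf_tree s, 0 < size s, label s 0 = Some x0,
    size s <= (size (x :: xs)).+1 * 2 ^ #|V|.-1
    & forall y, y \in [:: x0, x & xs] -> exists i, [/\ i < size s, label s i = Some y
      & blocks e (tree_adj s) (label s) [set~ y] [set z | e y z] i]].
  move=> wf1 lt_i lab_i le1.
  have [|s2 [wf2 B2 le2]] := grow_blocks [set~ x] wf1 lt_i (S := [set y | e x y]).
    by move=> y; rewrite inE lab_i.
  exists ((s ++ s1) ++ s2); split=> //.
  - by rewrite !size_cat; lia.
  - by rewrite !label_cat // size_cat; lia.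
  - move: le2 le1 le_s; rewrite cardsC1 !size_cat [size (x :: xs)]/=.
    by rewrite [_.+2 * _]mulSn; case: (_ \subset _); lia.
  - move=> y; rewrite !inE orbCA => /orP[/eqP ->|yxs].
      by exists i; rewrite label_cat // size_cat ltn_addr.
    have [|j [lt_j lab_j Bj]] := root_s y; first by rewrite inE.
    exists j; split; last by apply: blocks_cat; apply: blocks_cat.
      by rewrite !size_cat; lia.
    by rewrite !label_cat // size_cat; lia.
have [ex0x|nex0x] := boolP (e x0 x).
  apply: (grow [:: (0, Some x)] (size s)) => //.
  - by apply: wf_tree_rcons; rewrite ?lab0.
  - by rewrite size_cat addn1.
  - by rewrite label_size.
have wf1 : wf_tree (s ++ [:: (0, None)]).
  by apply: wf_tree_rcons => //; case: (label s 0).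
have size1 : size (s ++ [:: (0, @None V)]) = (size s).+1 by rewrite size_cat addn1.
(* The unlabelled node gets the index [size s], and the new root is its child. *)
apply: (grow [:: (0, None); (size s, Some x)] (size s).+1).
- rewrite -[[:: _; _]]cat1s catA; apply: wf_tree_rcons => //.
    by rewrite size1.
  by rewrite label_size.
- by rewrite size_cat addn2.
- by rewrite -size1 -[[:: _; _]]cat1s catA label_size.
- suff -> : ([set~ x] \subset [set y | e x y]) = false by [].
  apply/negP => /subsetP/(_ x0); rewrite !inE x0x e_sym (negPf nex0x).
  by move/(_ isT).
Qed.

(** * The list of parents as a tree on ordinals *)

Section Ordinals.
Variable s : seq (nat * option V).
Hypothesis wf_s : wf_tree s.

Definition ord_adj : rel 'I_(size s) := fun i j => tree_adj s i j.
Definition ord_label (i : 'I_(size s)) := label s i.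

Lemma ord_adj_sym : symmetric ord_adj.
Proof. by move=> i j; rewrite /ord_adj /tree_adj andbCA orbC. Qed.

Lemma parent_ord_adj (i j : 'I_(size s)) : ord_adj i j -> j < i -> parent s i = j.
Proof.
case/and3P=> _ lt_j /orP[/andP[_ /eqP//]|/andP[j_gt0 /eqP par_j]] ji.
by have [] := wf_s j_gt0 lt_j; rewrite par_j ltnNge (ltnW ji).
Qed.

Lemma ord_adj_irr : irreflexive ord_adj.
Proof.
move=> i; apply/negP; rewrite /ord_adj /tree_adj => /and3P[_ lt_i].
rewrite orbb => /andP[i_gt0 /eqP par_i].
by have [] := wf_s i_gt0 lt_i; rewrite par_i ltnn.
Qed.

Lemma ord_connect : forall i j, connect ord_adj i j.
Proof.
have to_root n (lt_n : n < size s) (lt_0 : 0 < size s) :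
    connect ord_adj (Ordinal lt_n) (Ordinal lt_0).
  elim/ltn_ind: n lt_n => n IH lt_n; have [n0|n_gt0] := posnP n.
    by rewrite (_ : Ordinal lt_n = Ordinal lt_0) ?connect0 //; apply: val_inj.
  have [lt_pn _] := wf_s n_gt0 lt_n.
  have lt_p := ltn_trans lt_pn lt_n.
  apply: connect_trans (IH _ lt_pn lt_p); apply: connect1.
  by rewrite /ord_adj /tree_adj lt_n lt_p n_gt0 eqxx.
move=> [i lt_i] [j lt_j]; have lt_0 := leq_ltn_trans (leq0n i) lt_i.
apply: connect_trans (to_root i lt_i lt_0) _.
by rewrite (sym_connect_sym ord_adj_sym); apply: to_root.
Qed.

(* The largest node of a cycle would have two distinct parents. *)
Lemma ord_acyclic (c : seq 'I_(size s)) :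
  uniq c -> 3 <= size c -> ~~ cycle ord_adj c.
Proof.
case: c => // i0 c0; set c := i0 :: c0 => c_uniq c_size.
have [i ic i_max] : exists2 i, i \in c & forall j, j \in c -> j <= i.
  have [i ic i_max] := @arg_maxnP _ i0 (mem c) val (mem_head _ _).
  by exists i => // j /i_max.
(* Rotated to begin with [i], the cycle has the neighbours [a] (second) and [b] (last) of [i],
   distinct as the length is at least 3. *)
have [k p Ec] := rot_to ic.
rewrite -(rot_cycle k); move: c_uniq c_size i_max.
rewrite -(rot_uniq k) -(size_rot k c) Ec => c_uniq c_size i_max'.
have i_max j : j \in i :: p -> j <= i.
  by rewrite -Ec mem_rot; apply: i_max'.
case: p c_uniq c_size i_max {Ec} => [|a p] //; case/lastP: p => [|p b] //.
move=> c_uniq _ i_max; apply/negP; rewrite /= rcons_path last_rcons.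
case/andP=> ia /andP[_ bi].
case/and3P: c_uniq => i_ab a_b _.
have i_a : i != a by apply: contraNneq i_ab => ->; rewrite mem_head.
have i_b : i != b by apply: contraNneq i_ab => ->; rewrite inE mem_rcons mem_head orbT.
have par j : j \in [:: i, a & rcons p b] -> i != j -> ord_adj i j -> parent s i = j.
  move=> jc ij aij; apply: parent_ord_adj => //.
  by rewrite ltn_neqAle i_max // andbT eq_sym.
move: a_b; have -> : a = b; last by rewrite mem_rcons mem_head.
apply: val_inj; rewrite /= -(par a) ?inE ?eqxx ?orbT // -(par b) //.
  by rewrite !inE mem_rcons inE eqxx !orbT.
by rewrite ord_adj_sym.
Qed.

Lemma ord_is_tree : 0 < size s -> is_tree ord_adj.
Proof.
move=> s_gt0; split; first by split; [exact: ord_adj_sym|exact: ord_adj_irr].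
split; first by rewrite card_ord.
by split; [exact: ord_connect|exact: ord_acyclic].
Qed.

Lemma ord_label_adj : forall i j x y,
  ord_label i = Some x -> ord_label j = Some y -> ord_adj i j -> e x y.
Proof.
move=> i j x y; rewrite /ord_label /ord_adj => lab_i lab_j.
case/and3P=> lt_i lt_j /orP[] /andP[gt0 /eqP par_ij].
  by have [_] := wf_s gt0 lt_i; rewrite par_ij lab_i lab_j /= e_sym.
by have [_] := wf_s gt0 lt_j; rewrite par_ij lab_i lab_j.
Qed.

Lemma ord_blocks U S i (lt_i : i < size s) :
  blocks e (tree_adj s) (label s) U S i ->
  blocks e ord_adj ord_label U S (Ordinal lt_i).
Proof.
move=> B; elim: B lt_i => {U S i} [U S i dUS|U S i x j ij lab_j _ IHj _ IHi] lt_i.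
  exact: blocks_nil.
have lt_j : j < size s by case/and3P: ij.
by apply: (blocks_cons (j := Ordinal lt_j)) (IHj _) (IHi _).
Qed.
End Ordinals.
End Grow.


(** * The tree and the embedding for a given graph *)

Theorem theorem3p12 (m : nat) (e : rel 'I_m) :
  0 < m -> simple_graph e ->
  exists (n : nat) (t : rel 'I_n),
    [/\ is_tree t, n <= m * 2 ^ (m - 1) & qi_group_embedding e t].
Proof.
move=> m_gt0 [e_sym _]; pose x0 := Ordinal m_gt0.
(* Listing all vertices but [x0] gives [m] trees, each costing at most [2 ^ (m - 1)] nodes with its
   link. *)
have [|s [wf_s s_gt0 _ le_s root_s]] :=
  @plant_trees _ e e_sym x0 (enum [set~ x0]).
  by rewrite mem_enum !inE eqxx.
have /fin_all_exists[root root_spec] : forall x, exists i : 'I_(size s),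
    ord_label i = Some x /\ blocks e (@ord_adj _ s) (@ord_label _ s)
      [set~ x] [set y | e x y] i.
  move=> x; have [|i [lt_i lab_i B]] := root_s x.
    by rewrite inE mem_enum !inE orbN.
  by exists (Ordinal lt_i); split=> //; apply: ord_blocks.
have lab_root x := (root_spec x).1; have blocks_root x := (root_spec x).2.
exists (size s), (@ord_adj _ s); split.
- exact: (ord_is_tree wf_s).
- by move: le_s; rewrite -cardE cardsC1 card_ord prednK // subn1.
have adj_sym := @ord_adj_sym _ s; have adj_lab := ord_label_adj e_sym wf_s.
exists (lift (@ord_label _ s)); split.
- exact: lift_hom.
- exact: lift_injective blocks_root.
- by apply: lift_qi blocks_root _; rewrite ?card_ord.
Qed.
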